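(* Let $H$ be a Hilbert space. For every bounded sequence $(u_n)_{n \in \mathbb{N}}$ in $H$ the inequality $$\limsup_{N \to \infty} \sup_{M \in \mathbb{N}}\left\|\frac{1}{N} \sum_{n=M+1}^{M+N} u_n\right\|^2 \leq \liminf_{J \to \infty} \frac{1}{J}\sum_{j=1}^J \limsup_{N \to \infty} \sup_{M \in \mathbb{N}}\frac{1}{N}\sum_{n=M+1}^{N+M} \operatorname{Re} (u_n|u_{n+j})$$ holds.
   Context: $\mathbb{N} = \{1,2,3,\dots\}$. Hilbert spaces are complex, and $(\cdot|\cdot)$ denotes the inner product of $H$ (linear in the first argument). *)

(* Defs.v *)
From HB Require Import structures.
From mathcomp Require Import all_boot all_order all_algebra.
From mathcomp Require Import all_classical all_reals all_analysis.
From mathcomp Require Export complex.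
Import Order.TTheory GRing.Theory Num.Theory numFieldNormedType.Exports.

Set Implicit Arguments.
Unset Strict Implicit.
Unset Printing Implicit Defensive.

Local Open Scope ring_scope.

(* [{dot H for Num.conj}] is the type of positive definite Hermitian forms,
   linear in the first argument and conjugate-linear in the second one.  The
   norm of a normed module over [R[i]] takes its values in [R[i]], so the
   axiom below is an equality in [R[i]]. *)
HB.mixin Record NormedModule_isInnerProduct (R : realType) (H : Type)
    & NormedModule R[i] H := {
  inner : {dot H for Num.conj} ;
  sqr_normE : forall x : H, `|x| ^+ 2 = inner x x
}.

#[short(type="hilbertType")]
HB.structure Definition Hilbert (R : realType) :=
  {H of CompleteNormedModule R[i] H & NormedModule_isInnerProduct R H}.

Notation "''[' x , y ]" := (inner x y) : ring_scope.

(* The norm as an element of [R] instead of [R[i]]. *)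
Definition hnorm (R : realType) (H : hilbertType R) (x : H) : R :=
  complex.Re `|x|.

(* Main.v *)
Require Import Defs.
From mathcomp Require Import all_boot all_order all_algebra.
From mathcomp Require Import all_classical all_reals all_analysis.
From mathcomp Require Import ring lra zify.
Import Order.TTheory GRing.Theory Num.Theory numFieldNormedType.Exports.
Local Open Scope classical_set_scope.
Local Open Scope ring_scope.

(** Let B bound the norms of u, and let c be a real number above the right-hand
    side; it suffices to bound the left-hand side by c, up to an arbitrary error.
    Let A_J u be the sequence whose n-th term is the mean of
    u (n + 1), ..., u (n + J). For a fixed J, the means of A_J u and of u over a
    long window are close, so u may be replaced by any fixed convex combination v
    of the sequences A_J u; by convexity the square of the norm of a mean of v is
    at most the mean of the squares of the norms of v.

    The usual choice v = A_J u leads to a Fejér-weighted sum of the upper limits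
    gamma j of the correlations at lags j < J. That sum is essentially a weighted
    average of the Cesàro means of gamma up to J, hence is not controlled by
    their lower limit.
    Instead, choose lengths J_1, ..., J_m whose Cesàro means
    (gamma 1 + ... + gamma J_i) / J_i are all below c; since these lengths can be
    taken arbitrarily large, one may impose J_(i+1) >= q J_i with q large. Let v
    be the average of the m sequences A_(J_i) u.

    Expanding the square of v n gives the mean over i and l of the inner products
    of A_(J_i) u and A_(J_l) u. The m diagonal terms contribute at most B^2 / m
    in total. For i < l, the sequence A_(J_l) u is nearly constant on windows of
    length J_i ([hnorm_mean_shift]), so the mean over n of the inner product with
    A_(J_i) u is nearly a mean of inner products of u itself with A_(J_l) u
    ([mean_reip_mean_mean_le]), over windows translated by at most J_i. These are
    Cesàro means of correlations up to the lag J_l, hence at most c asymptotically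
    ([mean_reip_mean_le]); the supremum over the positions of the windows absorbs
    the translations. Putting this together ([hnorm_mean_lacunary]) bounds the
    left-hand side by c + O(B^2 / q + B^2 / m). *)

(** * The real part of the inner product *)

Section RealPart.
Context {R : realType} {H : hilbertType R}.
Implicit Types x y z : H.

Definition reip x y : R := complex.Re '[x, y].

Lemma hnorm_ge0 x : 0 <= hnorm x.
Proof. by have := normr_ge0 x; rewrite lecE => /andP[_]. Qed.

Lemma normE x : `|x| = (hnorm x)%:C%C.
Proof.
have := normr_ge0 x; rewrite lecE => /andP[/eqP /= im0 _].
by rewrite /hnorm; case: `|x| im0 => a b /= ->.
Qed.

Lemma reipxx x : reip x x = hnorm x ^+ 2.
Proof. by rewrite /reip -sqr_normE normE -rmorphXn. Qed.

Lemma reipC x y : reip x y = reip y x.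
Proof.
rewrite /reip hermC expr0 mul1r /=.
by case: '[y, x].
Qed.

Lemma reipDl y : {morph (fun x => reip x y) : x z / x + z}.
Proof. by move=> x z; rewrite /reip linearDl raddfD. Qed.

Lemma reip0l y : reip 0 y = 0.
Proof. by have := reipDl y 0 0; rewrite addr0; lra. Qed.

Lemma reipZl (a : R) x y : reip (a%:C%C *: x) y = a * reip x y.
Proof.
rewrite /reip linearZl /=.
by case: '[x, y] => b c /=; rewrite mul0r subr0.
Qed.

Lemma reipBl x y z : reip (x - z) y = reip x y - reip z y.
Proof.
by have := reipDl y (x - z) z; rewrite subrK => ->; rewrite addrK.
Qed.

Lemma hnormD x y : hnorm (x + y) <= hnorm x + hnorm y.
Proof. by have := ler_normD x y; rewrite !normE -rmorphD lecR. Qed.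

Lemma hnormN x : hnorm (- x) = hnorm x.
Proof. by rewrite /hnorm normrN. Qed.

Lemma hnormZ (a : R) x : hnorm (a%:C%C *: x) = `|a| * hnorm x.
Proof.
have : `|a%:C%C *: x| = (`|a| * hnorm x)%:C%C.
  by rewrite normrZ normc_def /= expr0n addr0 sqrtr_sqr normE rmorphM.
by rewrite normE => /complexI.
Qed.

(** The Cauchy-Schwarz inequality, obtained by squaring the triangle
    inequality. *)
Lemma reip_le x y : reip x y <= hnorm x * hnorm y.
Proof.
have := hnormD x y.
rewrite -(ler_pXn2r (ltn0Sn 1)) ?nnegrE ?addr_ge0 ?hnorm_ge0//.
rewrite -reipxx reipDl reipC reipDl (reipC _ (x + y)) reipDl !reipxx (reipC y x).
nra.
Qed.

Lemma normr_reip_le x y : `|reip x y| <= hnorm x * hnorm y.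
Proof.
rewrite ler_norml lerNl reip_le andbT -(hnormN x).
apply: le_trans (reip_le _ _); have := reipBl 0 y x.
by rewrite sub0r reip0l sub0r => ->.
Qed.

Lemma complex_natV n : n%:R^-1 = (n%:R^-1 : R)%:C%C :> R[i].
Proof. by rewrite fmorphV rmorph_nat. Qed.

End RealPart.

(** * Means over windows of consecutive integers *)

(** The window is M + 1, ..., M + N. Real sequences are averaged in [R^o], so
    that one definition serves them together with sequences of vectors. *)
Definition mean {K : fieldType} {V : lmodType K} (M N : nat) (f : nat -> V) : V :=
  N%:R^-1 *: \sum_(M.+1 <= n < (M + N).+1) f n.

Section MeanAlgebra.
Context {K : fieldType} {V : lmodType K}.
Implicit Types (M N p : nat) (f g : nat -> V).

Lemma eq_mean M N f g :
  (forall n, (M < n <= M + N)%N -> f n = g n) -> mean M N f = mean M N g.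
Proof. by move=> fg; congr (_ *: _); apply: eq_big_nat => n; exact: fg. Qed.

Lemma mean_shift M N p f : mean (M + p) N f = mean M N (fun n => f (n + p)%N).
Proof.
congr (_ *: _); rewrite -addSn big_addn; congr bigop.
by congr index_iota; lia.
Qed.

Lemma mean_exchange M N M' N' (F : nat -> nat -> V) :
  mean M N (fun n => mean M' N' (F n)) =
  mean M' N' (fun p => mean M N (F ^~ p)).
Proof.
by rewrite /mean /= -!scaler_sumr exchange_big_nat/= !scalerA mulrC.

Qed.

Lemma meanD M N f g :
  mean M N (fun n => f n + g n) = mean M N f + mean M N g.
Proof. by rewrite /mean big_split scalerDr. Qed.

Lemma meanZ M N a f : mean M N (fun n => a *: f n) = a *: mean M N f.
Proof. by rewrite /mean /= -scaler_sumr !scalerA mulrC. Qed.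

Lemma meanB M N f g :
  mean M N (fun n => f n - g n) = mean M N f - mean M N g.
Proof. by rewrite /mean sumrB scalerBr. Qed.

End MeanAlgebra.

Lemma mean_cst {K : numFieldType} {V : lmodType K} M N (x : V) :
  (0 < N)%N -> mean M N (fun=> x) = x.
Proof.
move=> N0; rewrite /mean sumr_const_nat subSS addKn -[x *+ N]scaler_nat scalerA.
by rewrite mulVf ?scale1r// pnatr_eq0 -lt0n.
Qed.

Section MeanOrder.
Context {R : realType}.
Implicit Types (M N : nat) (f g : nat -> R^o).

Lemma le_mean M N f g :
  (forall n, (M < n <= M + N)%N -> f n <= g n) -> mean M N f <= mean M N g.
Proof.
move=> fg; apply: ler_wpM2l; first by rewrite invr_ge0.
by apply: ler_sum_nat => n; exact: fg.
Qed.

Lemma mean_le_cst M N f c : (0 < N)%N ->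
  (forall n, (M < n <= M + N)%N -> f n <= c) -> mean M N f <= c.
Proof. by move=> N0 fc; rewrite -(mean_cst M N (c : R^o) N0); exact: le_mean. Qed.

End MeanOrder.

Section HilbertMean.
Context {R : realType} {H : hilbertType R}.
Implicit Types (M N : nat) (f : nat -> H) (x y : H).

Lemma reip_meanl M N f y :
  reip (mean M N f) y = mean M N (fun n => reip (f n) y : R^o).
Proof.
rewrite /mean complex_natV reipZl; congr (_ * _).
exact: (big_morph _ (reipDl y) (reip0l y)).
Qed.

Lemma reip_meanr M N f y :
  reip y (mean M N f) = mean M N (fun n => reip y (f n) : R^o).
Proof.
by rewrite reipC reip_meanl; apply: eq_mean => n _; exact: reipC.
Qed.

Lemma hnorm_mean M N f :
  hnorm (mean M N f) <= mean M N (fun n => hnorm (f n) : R^o).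
Proof.
rewrite /mean complex_natV hnormZ ger0_norm ?invr_ge0//.
apply: ler_wpM2l; first by rewrite invr_ge0.
elim/big_ind2 : _ => //; first by rewrite /hnorm normr0.
by move=> x a y b xa yb; apply: (le_trans (hnormD _ _)); exact: lerD.
Qed.

Lemma hnorm_mean_le M N f b : (0 < N)%N ->
  (forall n, (M < n <= M + N)%N -> hnorm (f n) <= b) -> hnorm (mean M N f) <= b.
Proof.
by move=> N0 fb; apply: (le_trans (hnorm_mean _ _ _)); exact: mean_le_cst.
Qed.

Lemma hnorm_mean_sub_le M N f x b : (0 < N)%N ->
  (forall n, (M < n <= M + N)%N -> hnorm (f n - x) <= b) ->
  hnorm (mean M N f - x) <= b.
Proof.
move=> N0 fb; rewrite -[x in _ - x](mean_cst M N x N0) -meanB.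
exact: hnorm_mean_le.
Qed.

(** Jensen's inequality for the square of the norm: with [w] the mean of [f],
    average [2 * reip (f n) w <= hnorm (f n) ^+ 2 + hnorm w ^+ 2] over [n]. *)
Lemma hnorm_mean_sqr M N f : (0 < N)%N ->
  hnorm (mean M N f) ^+ 2 <= mean M N (fun n => hnorm (f n) ^+ 2 : R^o).
Proof.
move=> N0; set w := mean M N f.
have : mean M N (fun n => reip (f n) w : R^o) <=
    mean M N (fun n => 2^-1 *: (hnorm (f n) ^+ 2 + hnorm w ^+ 2) : R^o).
  apply: le_mean => n _; have := reip_le (f n) w.
  have := sqr_ge0 (hnorm (f n) - hnorm w).
  rewrite /GRing.scale/=; nra.
rewrite -reip_meanl reipxx meanZ meanD mean_cst// /GRing.scale/=; lra.
Qed.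

End HilbertMean.

(** * The van der Corput inequality with lacunary averages *)

Section VanDerCorput.
Context {R : realType} {H : hilbertType R} {u : nat -> H} {B : R}.
Context (uB : forall n, (0 < n)%N -> hnorm (u n) <= B).

Let B0 : 0 <= B.
Proof. exact: le_trans (hnorm_ge0 _) (uB 1 isT). Qed.

(** Moving a window one step to the right replaces a single term, which changes
    the sum by at most [2 * B]. *)
Lemma hnorm_mean_shift M N p :
  hnorm (mean (M + p) N u - mean M N u) <= 2 * B * p%:R / N%:R.
Proof.
rewrite -scalerBr complex_natV hnormZ ger0_norm ?invr_ge0// mulrC.
apply: ler_wpM2r; first by rewrite invr_ge0.
elim: p => [|p IHp]; first by rewrite addn0 subrr mulr0 /hnorm normr0.
set S := fun M => \sum_(M.+1 <= n < (M + N).+1) u n.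
have step k : S k.+1 = S k + u (k + N).+1 - u k.+1.
  have le_kN : (k.+1 <= (k + N).+1)%N by rewrite ltnS leq_addr.
  have := big_ltn (F := u) (op := +%R) (idx := 0) (le_kN : (k.+1 < (k + N).+2)%N).
  rewrite big_nat_recr//= => /eqP; rewrite [X in _ == X]addrC -subr_eq => /eqP ->.
  by rewrite /S addSn.
rewrite addnS -/(S _) -/(S M) step.
have -> : S (M + p)%N + u (M + p + N).+1 - u (M + p).+1 - S M =
          (S (M + p)%N - S M) + (u (M + p + N).+1 + (- u (M + p).+1)).
  by rewrite [RHS]addrACA [- S M + _]addrC !addrA.
apply: (le_trans (hnormD _ _)).
have := hnormD (u (M + p + N).+1) (- u (M + p).+1).
rewrite hnormN -natr1 => uu.
have := IHp; rewrite -/(S _) -/(S M).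
have := uB (M + p + N).+1 isT; have := uB (M + p).+1 isT.
lra.
Qed.

Lemma hnorm_mean_bound M N : (0 < N)%N -> hnorm (mean M N u) <= B.
Proof.
by move=> N0; apply: hnorm_mean_le => // n /andP[Mn _]; apply: uB; lia.
Qed.

(** By bilinearity the left-hand side is the mean over the lags [j] of the
    correlations at lag [j]. *)
Lemma mean_reip_mean_le M N L (g : nat -> R^o) c : (0 < L)%N ->
  (forall j, (0 < j <= L)%N ->
    mean M N (fun n => reip (u n) (u (n + j)%N) : R^o) <= g j) ->
  mean 0 L g <= c ->
  mean M N (fun n => reip (u n) (mean n L u) : R^o) <= c.
Proof.
move=> L0 ug; apply: le_trans.
rewrite (_ : mean M N _ = mean 0 L (fun j =>
    mean M N (fun n => reip (u n) (u (n + j)%N) : R^o))).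
  exact: le_mean.
rewrite -mean_exchange; apply: eq_mean => n _.
rewrite -[n in mean n]add0n mean_shift reip_meanr.
by apply: eq_mean => j _; rewrite addnC.
Qed.

(** Write the short average as a mean of the shifts [u (n + p)] with [p <= K].
    Since [K] is small compared with [L], the long average at [n] can be replaced
    by the one at [n + p], at a cost of [2 * B / q] in norm; translating the
    window of [n] by [p] then reduces each term to the hypothesis. This is why
    the hypothesis has to be uniform in the position [M'] of the window. *)
Lemma mean_reip_mean_mean_le M N K L (q : nat) c :
  (0 < N)%N -> (0 < K)%N -> (0 < q)%N -> (q * K <= L)%N ->
  (forall M', (0 < M')%N ->
    mean M' N (fun n => reip (u n) (mean n L u) : R^o) <= c) ->
  mean M N (fun n => reip (mean n K u) (mean n L u) : R^o)
    <= c + 2 * B ^+ 2 / q%:R.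
Proof.
move=> N0 K0 q0 qKL uc.
rewrite (_ : mean M N _ = mean 0 K (fun p =>
    mean M N (fun n => reip (u (n + p)%N) (mean n L u) : R^o))); last first.
  rewrite -mean_exchange; apply: eq_mean => n _.
  rewrite -[n in reip (mean n _ _)]add0n mean_shift reip_meanl.
  by apply: eq_mean => j _; rewrite addnC.
apply: mean_le_cst => // p /andP[p0 pK].
have L0 : (0 < L)%N by nia.
have pL : p%:R / L%:R <= q%:R^-1 :> R.
  rewrite ler_pdivrMr ?ltr0n// mulrC ler_pdivlMr ?ltr0n// -natrM ler_nat.
  by apply: leq_trans qKL; rewrite mulnC leq_mul2l pK orbT.
have shift n : reip (u (n + p)%N) (mean n L u) <=
    reip (u (n + p)%N) (mean (n + p) L u) + 2 * B ^+ 2 / q%:R.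
  have -> : mean n L u = mean (n + p) L u - (mean (n + p) L u - mean n L u).
    by rewrite opprB addrC subrK.
  rewrite reipC reipDl ![reip _ (u _)]reipC lerD2l.
  apply: (le_trans (reip_le _ _)); rewrite hnormN.
  have -> : 2 * B ^+ 2 / q%:R = B * (2 * B / q%:R) by ring.
  apply: ler_pM; rewrite ?hnorm_ge0//; first by apply: uB; lia.
  apply: (le_trans (hnorm_mean_shift _ _ _)).
  by rewrite -mulrA ler_wpM2l ?mulr_ge0.
apply: (@le_trans _ _ (mean M N (fun n =>
    reip (u (n + p)%N) (mean (n + p) L u) + 2 * B ^+ 2 / q%:R : R^o))).
  by apply: le_mean => n _; exact: shift.
rewrite meanD mean_cst// lerD2r -(mean_shift M N p
  (fun n => reip (u n) (mean n L u) : R^o)); apply: uc; lia.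
Qed.

(** A row of the matrix [F] holds one diagonal entry and [m - 1] entries off the
    diagonal. *)
Lemma mean_diag_le m (F : nat -> nat -> R) b c : (0 < m)%N ->
  (forall i, (0 < i <= m)%N -> F i i <= b) ->
  (forall i l, (0 < i <= m)%N -> (0 < l <= m)%N -> i != l -> F i l <= c) ->
  mean 0 m (fun i => mean 0 m (fun l => F i l : R^o)) <= c + (b - c) / m%:R.
Proof.
move=> m0 Fb Fc; apply: mean_le_cst => // i im.
have -> : c + (b - c) / m%:R =
    mean 0 m (fun l => c + (l == i)%:R *: (b - c : R^o) : R^o).
  rewrite meanD mean_cst//; congr (_ + _).
  rewrite /mean (big_cat_nat _ (n := i))/=; [|lia|lia].
  rewrite big_nat big1 ?add0r; last first.
    by move=> l li; rewrite (_ : (l == i) = false) ?scale0r//; lia.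
  rewrite big_ltn ?eqxx ?scale1r; last lia.
  rewrite big_nat big1 ?addr0; last first.
    by move=> l li; rewrite (_ : (l == i) = false) ?scale0r//; lia.
  by rewrite mulrC.
apply: le_mean => l lm; have [->|li] := eqVneq l i.
  by rewrite scale1r addrC subrK; exact: Fb.
by rewrite scale0r addr0; apply: Fc => //; rewrite eq_sym.
Qed.

(** Averaging over [i] the averages of [u] on windows of lengths [J i] gives a
    sequence whose means are small in norm: expanding the square produces the
    correlations between the averages of lengths [J i] and [J l]. For [i = l]
    only the trivial bound [B ^+ 2] holds, but these terms have weight [1 / m];
    for [i != l] one length is much smaller than the other. *)
Lemma hnorm_mean_lacunary M N (J : nat -> nat) (m q : nat) (g : nat -> R^o) c C :
  (0 < N)%N -> (0 < m)%N -> (0 < q)%N ->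
  (forall i, (0 < J i)%N) ->
  (forall i l, (i < l)%N -> (q * J i <= J l)%N) ->
  (forall i, (0 < i <= m)%N -> mean 0 (J i) g <= c) ->
  (forall M' i j, (0 < M')%N -> (0 < i <= m)%N -> (0 < j <= J i)%N ->
    mean M' N (fun n => reip (u n) (u (n + j)%N) : R^o) <= g j) ->
  c + 2 * B ^+ 2 / q%:R <= C ->
  hnorm (mean M N (fun n => mean 0 m (fun i => mean n (J i) u))) ^+ 2
    <= C + (B ^+ 2 - C) / m%:R.
Proof.
move=> N0 m0 q0 J0 qJ gc ug cC.
apply: (le_trans (hnorm_mean_sqr _ _ _ N0)).
rewrite (_ : mean M N _ = mean 0 m (fun i => mean 0 m (fun l =>
    mean M N (fun n => reip (mean n (J i) u) (mean n (J l) u) : R^o)))).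
  have cross i l : (0 < l <= m)%N -> (i < l)%N ->
      mean M N (fun n => reip (mean n (J i) u) (mean n (J l) u) : R^o) <= C.
    move=> lm il; apply: le_trans cC.
    apply: mean_reip_mean_mean_le => //; first exact: qJ.
    move=> M' M'0; apply: (mean_reip_mean_le _ _ _ g) => //; last exact: gc.
    by move=> j jl; apply: (ug _ l).
  apply: mean_diag_le => // [i _|i l im lm].
    apply: mean_le_cst => // n _; rewrite reipxx.
    by rewrite ler_pXn2r ?nnegrE ?hnorm_ge0// hnorm_mean_bound.
  rewrite neq_ltn => /orP[|li]; first exact: cross.
  rewrite (_ : mean M N _ =
      mean M N (fun n => reip (mean n (J l) u) (mean n (J i) u) : R^o)).
    exact: cross.
  by apply: eq_mean => n _; exact: reipC.
transitivity (mean M N (fun n => mean 0 m (fun i => mean 0 m (fun l =>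
   reip (mean n (J i) u) (mean n (J l) u) : R^o)))).
  apply: eq_mean => n _; rewrite -reipxx reip_meanl.
  by apply: eq_mean => i _; exact: reip_meanr.
by rewrite mean_exchange; apply: eq_mean => i _; exact: mean_exchange.
Qed.

(** Averaging [u] over short windows hardly changes its means over long ones:
    after an exchange of the means, only translates of the window
    M + 1, ..., M + N by at most [K] occur. *)
Lemma hnorm_mean_smoothing M N (J : nat -> nat) m K :
  (0 < N)%N -> (0 < m)%N -> (forall i, (0 < i <= m)%N -> (0 < J i <= K)%N) ->
  hnorm (mean M N u - mean M N (fun n => mean 0 m (fun i => mean n (J i) u)))
    <= 2 * B * K%:R / N%:R.
Proof.
move=> N0 m0 JK; rewrite -hnormN opprB mean_exchange.
apply: hnorm_mean_sub_le => // i /JK/andP[Ji0 JiK].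
rewrite (_ : mean M N _ = mean 0 (J i) (fun j => mean (M + j) N u)); last first.
  under [RHS]eq_mean do rewrite mean_shift.
  rewrite -mean_exchange; apply: eq_mean => n _.
  rewrite -[n in mean n]add0n mean_shift.
  by apply: eq_mean => j _; rewrite addnC.
apply: hnorm_mean_sub_le => // j /andP[_ jJi].
apply: (le_trans (hnorm_mean_shift _ _ _)).
by rewrite ler_wpM2r// ler_wpM2l ?mulr_ge0// ler_nat; lia.
Qed.

End VanDerCorput.

(** * Upper and lower limits, and lacunary choices *)

Section Sequences.
Context {R : realType}.
Implicit Types (f : nat -> \bar R) (c : \bar R) (x y : \bar R).

Lemma limn_esup_lt_near f c :
  (limn_esup f < c)%E -> \forall n \near \oo, (f n < c)%E.
Proof.
move=> /ereal_inf_lt[_ [V oV <-] Vc].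
near=> n; apply: le_lt_trans Vc; apply: ereal_sup_ubound; exists n => //.
by near: n; exact: oV.
Unshelve. all: by end_near. Qed.

Lemma limn_esup_le_near f c :
  (\forall n \near \oo, (f n <= c)%E) -> (limn_esup f <= c)%E.
Proof.
move=> fc; apply: (@le_trans _ _ (ereal_sup (f @` [set n | (f n <= c)%E]))).
  by apply: ereal_inf_lbound; exists [set n | (f n <= c)%E].
by apply: ge_ereal_sup => _ [n fnc <-].
Qed.

Lemma limn_esup_ge_near f c :
  (\forall n \near \oo, (c <= f n)%E) -> (c <= limn_esup f)%E.
Proof.
move=> cf; rewrite leNgt; apply/negP => /limn_esup_lt_near fc.
have [n [cfn]] := filter_ex (filterI cf fc).
by rewrite ltNge cfn.
Qed.

Lemma limn_einf_lt_frequently f c : (limn_einf f < c)%E ->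
  forall k, exists2 n, (k <= n)%N & (f n < c)%E.
Proof.
move=> fc k; apply: contrapT => nfc; move: fc; apply/negP.
rewrite -leNgt leeNr; apply: limn_esup_le_near.
near=> n; rewrite leeNl oppeK leNgt; apply/negP => fnc.
by apply: nfc; exists n => //; near: n; exact: nbhs_infty_ge.
Unshelve. all: by end_near. Qed.

Lemma lee_forall_gt_fin x y :
  (forall r : R, (y < r%:E)%E -> (x <= r%:E)%E) -> (x <= y)%E.
Proof.
case: y => [s| |] xle; rewrite ?leey//.
  by apply/lee_addgt0Pr => e e0; apply: xle; rewrite lte_fin ltrDl.
by rewrite (@eq_ninfty _ x)// => r; apply: xle; exact: ltNyr.
Qed.

Lemma div_natr_small (a e : R) : 0 < e ->
  exists2 n, (0 < n)%N & forall k, (n <= k)%N -> a / k%:R <= e.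
Proof.
move=> e0; exists (Num.bound (`|a| / e)).+1 => // k nk.
rewrite ler_pdivrMr ?ltr0n; last lia.
have := @archi_boundP R (`|a| / e); rewrite divr_ge0 ?(ltW e0)// => /(_ isT).
rewrite ltr_pdivrMr// mulrC => ae.
apply: (le_trans (ler_norm a)); apply: (le_trans (ltW ae)).
by rewrite ler_pM2l// ler_nat; lia.
Qed.

Lemma lacunary_subsequence (P : nat -> Prop) q : (0 < q)%N ->
  (forall k, exists2 n, (k <= n)%N & P n) ->
  exists J : nat -> nat, [/\ forall i, (0 < J i)%N, forall i, P (J i) &
    forall i l, (i < l)%N -> (q * J i <= J l)%N].
Proof.
move=> q0 Pf; have /choice[f fP] k : exists n, (k <= n)%N /\ P n.
  by have [n kn Pn] := Pf k; exists n.
pose J i := iter i (fun k => f (q * k).+1) (f 1).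
have Jstep i : (q * J i < J i.+1)%N by have [] := fP (q * J i).+1.
exists J; split=> [[|i]|[|i]|i l].
- by have [] := fP 1.
- by apply: leq_ltn_trans (Jstep i).
- by have [] := fP 1.
- by have [] := fP (q * J i).+1.
- elim: l => // l IHl; rewrite ltnS leq_eqVlt => /orP[/eqP->|/IHl]; first exact: ltnW.
  by move=> ql; have := Jstep l; nia.
Qed.

End Sequences.

(** * From finite means to upper and lower limits *)

Section FiniteBound.
Context {R : realType} {H : hilbertType R} {u : nat -> H} {B : R}.
Context (uB : forall n, (0 < n)%N -> hnorm (u n) <= B).

(** The error [e] is spent in quarters: on the ratio [q] of consecutive lengths,
    on the diagonal terms through [m], on smoothing through [N0], and a quarter
    is left over. Only the lags up to [K], fixed before [N], are involved, which
    allows for a bound [g] that holds for large [N] only. *)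
Lemma hnorm_mean_sqr_le (g : nat -> R^o) c e : 0 < e ->
  (forall k, exists2 J, (k <= J)%N & mean 0 J g <= c) ->
  exists K N0, forall N, (N0 <= N)%N ->
    (forall M j, (0 < M)%N -> (0 < j <= K)%N ->
      mean M N (fun n => reip (u n) (u (n + j)%N) : R^o) <= g j) ->
    forall M, hnorm (mean M N u) ^+ 2 <= c + e.
Proof.
move=> e0 gc; have e4 : 0 < e / 4 by lra.
have B0 : 0 <= B := le_trans (hnorm_ge0 _) (uB 1 isT).
have [q q0 /(_ q (leqnn q)) qe] := div_natr_small (2 * B ^+ 2) (e / 4) e4.
have [m m0 /(_ m (leqnn m)) me] :=
  div_natr_small (B ^+ 2 - (c + e / 4)) (e / 4) e4.
have [J [J0 Jc qJ]] := lacunary_subsequence _ q q0 gc.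
have JK i : (0 < i <= m)%N -> (0 < J i <= J m)%N.
  move=> /andP[_]; rewrite J0/= leq_eqVlt => /orP[/eqP->//|/qJ]; nia.
have [N1 N10 Ne] := div_natr_small (4 * B ^+ 2 * (J m)%:R) (e / 4) e4.
exists (J m), N1 => N N1N corr M; have N0 : (0 < N)%N by lia.
set v := fun n => mean 0 m (fun i => mean n (J i) u).
(* The sequence [v] has means of small norm, and those of [u] are close to
   them; the squares of the norms of the two means differ by at most [2 * B]
   times the distance. *)
have v_le : hnorm (mean M N v) ^+ 2 <= c + e / 4 + e / 4.
  apply: (@le_trans _ _ (c + e / 4 + (B ^+ 2 - (c + e / 4)) / m%:R)); last lra.
  apply: (hnorm_mean_lacunary uB M N J m q g c) => //; last lra.
  by move=> M' i j M'0 /JK/andP[_ JiK] j0; apply: corr => //; lia.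
have uvK := hnorm_mean_smoothing uB M N J m (J m) N0 m0 JK.
have uv : hnorm (mean M N u) <= hnorm (mean M N v) + 2 * B * (J m)%:R / N%:R.
  rewrite -lerBlDl; apply: le_trans uvK; rewrite lerBlDl.
  by apply: le_trans (hnormD _ _); rewrite addrC subrK.
have vB : hnorm (mean M N v) <= B.
  apply: hnorm_mean_le => // n Mn; apply: hnorm_mean_le => // i im.
  exact: hnorm_mean_bound.
have ub := hnorm_mean_bound uB M N N0.
have := Ne N N1N.
rewrite (_ : 4 * _ * _ / _ = 2 * B * (2 * B * (J m)%:R / N%:R)); last by ring.
move: uv; set d := 2 * B * _ / _ => uv de.
have d0 : 0 <= d by rewrite /d !mulr_ge0.
have a0 := hnorm_ge0 (mean M N u); have b0 := hnorm_ge0 (mean M N v).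
nra.
Qed.

End FiniteBound.

Theorem corollary5p2 (R : realType) (H : hilbertType R) (u : nat -> H)
    (u_bounded : [bounded u n | n in [set n | (0 < n)%N]]) :
  (limn_esup (fun N : nat =>
     ereal_sup [set (hnorm (N%:R^-1 *: \sum_(M.+1 <= n < (M + N).+1) u n) ^+ 2)%:E
               | M in [set M | (0 < M)%N]])
   <= limn_einf (fun J : nat =>
        (J%:R^-1)%:E * \sum_(1 <= j < J.+1)
          limn_esup (fun N : nat =>
            ereal_sup [set (N%:R^-1 * \sum_(M.+1 <= n < (N + M).+1)
                              complex.Re '[u n, u (n + j)%N])%:E
                      | M in [set M | (0 < M)%N]])))%E.
Proof.
have [B uB] : exists B, forall n, (0 < n)%N -> hnorm (u n) <= B.
  have [b _ u_b] := pinfty_ex_gt0 u_bounded; exists (complex.Re b) => n n0.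
  by have : `|u n| <= b := u_b n n0; rewrite lecE => /andP[].
have B0 : 0 <= B := le_trans (hnorm_ge0 _) (uB 1 isT).
pose corr j M N : R := mean M N (fun n => reip (u n) (u (n + j)%N) : R^o).
pose S j N := ereal_sup [set (corr j M N)%:E | M in [set M | (0 < M)%N]].
have corrB j M N : (0 < N)%N -> - B ^+ 2 <= corr j M N <= B ^+ 2.
  move=> N0.
  have uuB n : (M < n)%N -> `|reip (u n) (u (n + j)%N)| <= B ^+ 2.
    move=> Mn; apply: (le_trans (normr_reip_le _ _)).
    by apply: ler_pM; rewrite ?hnorm_ge0 ?uB//; lia.
  rewrite -[leLHS](mean_cst M N (- B ^+ 2 : R^o) N0).
  apply/andP; split; [apply: le_mean|apply: mean_le_cst => //];
    by move=> n /andP[/uuB]; rewrite ler_norml => /andP[].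
(* The upper limits on the right are finite, so that their averages are real
   means. *)
pose g j := fine (limn_esup (S j)).
have gE j : limn_esup (S j) = (g j)%:E.
  rewrite fineK// fin_numElt; apply/andP; split.
    apply: (@lt_le_trans _ _ (- B ^+ 2)%:E); first exact: ltNyr.
    apply: limn_esup_ge_near; near=> N.
    have N0 : (0 < N)%N by near: N; exact: nbhs_infty_gt.
    apply: (@le_trans _ _ (corr j 1 N)%:E).
      by rewrite lee_fin; have /andP[] := corrB j 1 N N0.
    by apply: ereal_sup_ubound; exists 1.
  apply: (@le_lt_trans _ _ (B ^+ 2)%:E); last exact: ltry.
  apply: limn_esup_le_near; near=> N.
  have N0 : (0 < N)%N by near: N; exact: nbhs_infty_gt.
  apply: ge_ereal_sup => _ [M _ <-].
  by rewrite lee_fin; have /andP[] := corrB j M N N0.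
rewrite [leRHS](_ : _ =
    limn_einf (fun J => (mean 0 J (g : nat -> R^o))%:E)); last first.
  congr limn_einf; apply/funext => J.
  rewrite [X in (_ * X)%E](_ : _ = (\sum_(1 <= j < J.+1) g j)%:E) -?EFinM//.
  rewrite -sumEFin; apply: eq_bigr => j _; rewrite -gE; congr limn_esup.
  by apply/funext => N; congr ereal_sup; apply: eq_imagel => M _; rewrite addnC.
apply: lee_forall_gt_fin => c /limn_einf_lt_frequently gc.
apply/lee_addgt0Pr => e e0; rewrite -EFinD.
have e2 : 0 < e / 2 by lra.
(* The correlations at lag [j] exceed their upper limit by at most [e / 2] for
   all large [N], uniformly for [j <= K]. *)
pose g' j : R^o := g j + e / 2.
have g'c k : exists2 J, (k <= J)%N & mean 0 J g' <= c + e / 2.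
  have [J kJ] := gc k.+1; rewrite lte_fin => gJ; exists J; first lia.
  by rewrite meanD mean_cst ?lerD2r ?ltW//; lia.
have [K [N0 vdc]] := hnorm_mean_sqr_le uB g' (c + e / 2) (e / 2) e2 g'c.
have near_corr : \forall N \near \oo, forall j : 'I_K.+1, (S j N < (g' j)%:E)%E.
  apply: filter_forall => j; apply: limn_esup_lt_near.
  by rewrite gE lte_fin ltrDl.
apply: limn_esup_le_near; near=> N.
have SN : forall j : 'I_K.+1, (S j N < (g' j)%:E)%E by near: N.
apply: ge_ereal_sup => _ [M _ <-]; rewrite lee_fin.
rewrite (_ : c + e = c + e / 2 + e / 2); last lra.
apply: vdc; first by near: N; exact: nbhs_infty_ge.
move=> M' j M'0 /andP[_ jK]; rewrite -lee_fin; apply: ltW.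
apply: le_lt_trans (SN (Ordinal (jK : (j < K.+1)%N))).
by apply: ereal_sup_ubound; exists M'.
Unshelve. all: by end_near. Qed.
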